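(* Let $R$ be the Rado complex. (a) $R$ is universal: every simplicial complex with a countable set of vertexes is isomorphic to an induced subcomplex of $R$. (b) $R$ is homogeneous: for every two finite subsets $U,U'\subseteq V(R)$ and every isomorphism $f:R_U\to R_{U'}$ there exists an isomorphism $F:R\to R$ with $F|_{R_U}=f$. (c) Every countable simplicial complex which is universal and homogeneous (in the senses of (a) and (b)) is isomorphic to $R$.
   Context: For $U\subseteq V(X)$, $X_U$ denotes the induced subcomplex on $U$; $\mathrm{Lk}_X(v)$ is the subcomplex of simplexes $\sigma$ with $v\notin\sigma$ and $\sigma\cup\{v\}\in X$. A nonempty simplicial complex $X$ is $\infty$-ample if for every finite $U\subseteq V(X)$ and every subcomplex $A\subseteq X_U$ (possibly empty) there exists $v\in V(X)\setminus U$ with $\mathrm{Lk}_X(v)\cap X_U=A$. The Rado complex $R$ is the (unique up to isomorphism) $\infty$-ample simplicial complex with a countable set of vertexes; it is known that such a complex exists and any two are isomorphic. *)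

(* Defs.v *)
From mathcomp Require Import all_boot.
From mathcomp Require Import boolp classical_sets functions cardinality.

Set Implicit Arguments.
Unset Strict Implicit.
Unset Printing Implicit Defensive.

Local Open Scope classical_set_scope.

(* The set V(X) is the whole type [vertex X]; the empty set is not a simplex. *)
Record complex := Complex {
  vertex : Type;
  simplexes : set (set vertex);
  simplex_finite : forall s, simplexes s -> finite_set s;
  simplex_nonempty : forall s, simplexes s -> s !=set0;
  simplex_vertex : forall v, simplexes [set v];
  simplex_sub : forall s t, simplexes s -> t `<=` s -> t !=set0 -> simplexes t
}.
Arguments simplexes : clear implicits.

(* Subcomplexes are families of simplexes over the ambient vertex type: the
   vertexes of A are the v with A [set v].  A may be empty. *)
Definition subcomplex (V : Type) (A B : set (set V)) : Prop :=
  A `<=` B /\ forall s t, A s -> t `<=` s -> t !=set0 -> A t.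

Definition induced_simplexes (X : complex) (U : set (vertex X)) :
    set (set (vertex X)) :=
  [set s | simplexes X s /\ s `<=` U].

Definition link_simplexes (X : complex) (v : vertex X) :
    set (set (vertex X)) :=
  [set s | [/\ simplexes X s, ~ s v & simplexes X (s `|` [set v])]].

Section Induced.
Variables (X : complex) (U : set (vertex X)).

(* [induced_simplexes U], transported to the vertex type U. *)
Let simp : set (set U) := [set s | induced_simplexes U (val @` s)].

Let simp_finite s : simp s -> finite_set s.
Proof.
case=> /simplex_finite + _; rewrite (eq_finite_set (B := s)) //.
have vi : {in s &, injective (val : U -> vertex X)} by move=> x y _ _ /val_inj.
exact: inj_card_eq.
Qed.

Let simp_nonempty s : simp s -> s !=set0.
Proof. by case=> /simplex_nonempty [_ [x sx _]] _; exists x. Qed.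

Let simp_vertex v : simp [set v].
Proof.
split; first by rewrite image_set1; exact: simplex_vertex.
by move=> _ [x _ <-]; exact: set_valP.
Qed.

Let simp_sub s t : simp s -> t `<=` s -> t !=set0 -> simp t.
Proof.
case=> Xs sU ts [x tx]; have vts := image_subset (val : U -> vertex X) ts.
split; last exact: subset_trans sU.
by apply: simplex_sub Xs vts _; exists (val x), x.
Qed.

Definition induced : complex :=
  Complex simp_finite simp_nonempty simp_vertex simp_sub.

End Induced.

Definition isomorphism (X Y : complex) (f : vertex X -> vertex Y) : Prop :=
  bijective f /\ forall s, simplexes X s <-> simplexes Y (f @` s).

Definition isomorphic (X Y : complex) : Prop :=
  exists f : vertex X -> vertex Y, isomorphism f.

(* Countable means finite or countably infinite. *)
Definition countable_complex (X : complex) : Prop :=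
  countable [set: vertex X].

Definition infinitely_ample (X : complex) : Prop :=
  [set: vertex X] !=set0 /\
  forall U : set (vertex X), finite_set U ->
  forall A : set (set (vertex X)), subcomplex A (induced_simplexes U) ->
  exists v : vertex X,
    ~ U v /\ link_simplexes v `&` induced_simplexes U = A.

Definition rado_complex (R : complex) : Prop :=
  countable_complex R /\ infinitely_ample R.

Definition universal (X : complex) : Prop :=
  forall Y : complex, countable_complex Y ->
  exists U : set (vertex X), isomorphic Y (induced U).

Definition homogeneous (X : complex) : Prop :=
  forall U U' : set (vertex X), finite_set U -> finite_set U' ->
  forall f : vertex (induced U) -> vertex (induced U'), isomorphism f ->
  exists F : vertex X -> vertex X,
    isomorphism F /\ forall x : U, F (val x) = val (f x).

(* Main.v *)
From mathcomp Require Import all_boot.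
From mathcomp Require Import boolp classical_sets functions cardinality.
Require Import Defs.

Set Implicit Arguments.
Unset Strict Implicit.
Unset Printing Implicit Defensive.

Local Open Scope classical_set_scope.

(** Everything is a back-and-forth argument on partial isomorphisms.  Call a
    complex [Y] extensible over [X] when every finite partial isomorphism from
    [X] to [Y] extends to any further vertex of [X].  An ample [Y] is
    extensible over every [X]: ask for a vertex whose link is prescribed by
    the link of the new vertex of [X].  A universal and homogeneous [Y] is
    extensible over every countable [X]: embed [X] in [Y], and correct the
    embedding by an automorphism of [Y] so that it agrees with the given
    finite partial isomorphism.  Going forth only yields universality; going
    back and forth yields homogeneity and uniqueness. *)

(* A partial isomorphism is given by its graph P; quantifying over the subsets
   t of the graph keeps the definition symmetric in X and Y. *)
Definition partial_iso (X Y : complex) (P : set (vertex X * vertex Y)) :=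
  [/\ forall x y y', P (x, y) -> P (x, y') -> y = y',
      forall x x' y, P (x, y) -> P (x', y) -> x = x' &
      forall t, t `<=` P -> simplexes X (fst @` t) <-> simplexes Y (snd @` t)].

Definition converse (S T : Type) (P : set (S * T)) : set (T * S) :=
  [set p | P (p.2, p.1)].

Definition extensible (X Y : complex) :=
  forall P : set (vertex X * vertex Y), finite_set P -> partial_iso P ->
  forall x, exists y, partial_iso (P `|` [set (x, y)]).

Lemma image_fst_converse (S T : Type) (P : set (S * T)) :
  fst @` converse P = snd @` P.
Proof.
by apply/seteqP; split=> z [[a b] ? <-]; exists (b, a).
Qed.

Lemma image_snd_converse (S T : Type) (P : set (S * T)) :
  snd @` converse P = fst @` P.
Proof.
by apply/seteqP; split=> z [[a b] ? <-]; exists (b, a).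
Qed.

Lemma finite_converse (S T : Type) (P : set (S * T)) :
  finite_set P -> finite_set (converse P).
Proof.
move=> /(finite_image (fun p => (p.2, p.1))); apply: sub_finite_set.
by move=> [a b] Pab; exists (b, a).
Qed.

(** * Partial isomorphisms as graphs *)

Section PartialIso.
Variables X Y : complex.
Implicit Types (P Q : set (vertex X * vertex Y)).

Lemma partial_iso_sub P Q : P `<=` Q -> partial_iso Q -> partial_iso P.
Proof.
move=> PQ [Q1 Q2 Q3]; split.
- by move=> x y y' /PQ ? /PQ; apply: Q1.
- by move=> x x' y /PQ ? /PQ; apply: Q2.
- by move=> t tP; apply: Q3; apply: subset_trans PQ.
Qed.

Lemma partial_iso_converse P : partial_iso P -> partial_iso (converse P).
Proof.
move=> [P1 P2 P3]; split.
- by move=> x y y'; apply: P2.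
- by move=> x x' y; apply: P1.
- move=> t tP; rewrite -image_fst_converse -image_snd_converse.
  by apply: iff_sym; apply: P3 => -[a b] /tP.
Qed.

Lemma partial_iso0 : partial_iso (set0 : set (vertex X * vertex Y)).
Proof.
split=> // t; rewrite subset0 => ->; rewrite !image_set0.
by split=> /simplex_nonempty [].
Qed.

Lemma partial_iso_total P : partial_iso P ->
  (forall x, exists y, P (x, y)) ->
  exists f : vertex X -> vertex Y, [/\ forall x, P (x, f x), injective f &
    forall s, simplexes X s <-> simplexes Y (f @` s)].
Proof.
move=> [P1 P2 P3] /choice [f Pf]; exists f; split=> //.
  by move=> x x' fxx'; apply: (P2 x x' (f x)); rewrite // fxx'.
move=> s; have := P3 ((fun x => (x, f x)) @` s).
by rewrite !image_comp /= image_id; apply=> _ [x _ <-].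
Qed.

Lemma partial_iso_isomorphism P : partial_iso P ->
  (forall x, exists y, P (x, y)) -> (forall y, exists x, P (x, y)) ->
  exists f : vertex X -> vertex Y, isomorphism f /\ forall x, P (x, f x).
Proof.
move=> piP totP /choice [g Pg].
have [f [Pf fI fs]] := partial_iso_total piP totP.
exists f; split=> //; split=> //; case: piP => P1 P2 _.
exists g => x; first exact: (P2 _ _ (f x)).
exact: (P1 (g x)).
Qed.

(** Together with [partial_iso_sub], this turns every restriction of an embedding into a partial
    isomorphism. *)
Lemma graph_partial_iso (f : vertex X -> vertex Y) : injective f ->
  (forall s, simplexes X s <-> simplexes Y (f @` s)) ->
  partial_iso [set p | p.2 = f p.1].
Proof.
move=> fI fs; split=> /=.
- by move=> x y y' -> ->.
- by move=> x x' y -> /fI.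
- move=> t tf; rewrite fs image_comp.
  suff -> : (f \o fst) @` t = snd @` t by [].
  by apply: eq_imagel => p /tf.
Qed.

(** * Unions of chains of finite partial isomorphisms *)

Lemma finite_sub_chain (T : Type) (P : nat -> set T) (t : set T) :
  (forall n, P n `<=` P n.+1) -> finite_set t ->
  (forall x, t x -> exists n, P n x) -> exists n, t `<=` P n.
Proof.
move=> Pmono /(@finite_seqP {classic T}) [s ->].
have Ple m n : m <= n -> P m `<=` P n.
  by move/subnK <-; elim: (n - m) => // k IH; apply: subset_trans IH (Pmono _).
elim: s => [|a s IH] h; first by exists 0 => x; rewrite /= in_nil.
have [|n sn] := IH; first by move=> x xs; apply: h; rewrite /= inE xs orbT.
have [|m am] := h a; first by rewrite /= mem_head.
exists (maxn m n) => x; rewrite /= inE => /orP [/eqP ->|xs].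
  by apply: (Ple m) am; exact: leq_maxl.
by apply: (Ple n); [exact: leq_maxr | exact: sn].
Qed.

(* D n is the requirement to be met at stage n of the construction. *)
Lemma partial_iso_chain (D : nat -> set (vertex X * vertex Y) -> Prop) P0 :
  (forall n P Q, P `<=` Q -> D n P -> D n Q) ->
  (forall n P, finite_set P -> partial_iso P ->
     exists Q, [/\ finite_set Q, partial_iso Q, P `<=` Q & D n Q]) ->
  finite_set P0 -> partial_iso P0 ->
  exists Q, [/\ partial_iso Q, P0 `<=` Q & forall n, D n Q].
Proof.
move=> Dmono step fin0 iso0.
(* [choice] asks for an answer at every pair, so the premises of [step] go under the existential;
   pairs that violate them get the junk value [set0]. *)
have /choice [next nextP] (np : nat * set (vertex X * vertex Y)) :
    exists Q, finite_set np.2 -> partial_iso np.2 ->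
      [/\ finite_set Q, partial_iso Q, np.2 `<=` Q & D np.1 Q].
  case: (pselect (finite_set np.2 /\ partial_iso np.2)) => [[h1 h2]|h].
    by have [Q HQ] := step np.1 _ h1 h2; exists Q.
  by exists set0 => h1 h2; case: h.
pose P := fix P n := if n is m.+1 then next (m, P m) else P0.
have PP n : finite_set (P n) /\ partial_iso (P n).
  by elim: n => [//|n [h1 h2]] /=; have [] := nextP (n, P n) h1 h2.
have PS n : P n `<=` P n.+1 /\ D n (P n.+1).
  by have [h1 h2] := PP n; have [] := nextP (n, P n) h1 h2.
pose Q := [set p | exists n, P n p].
have PQ n : P n `<=` Q by move=> p; exists n.
have chain t : finite_set t -> t `<=` Q -> exists n, t `<=` P n.
  by apply: finite_sub_chain => n; have [] := PS n.
have chain2 p q : Q p -> Q q -> exists n, P n p /\ P n q.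
  move=> Qp Qq; have [||n h] := chain ([set p] `|` [set q]).
  - by rewrite finite_setU; split; exact: finite_set1.
  - by move=> _ [] ->.
  - by exists n; split; apply: h; [left | right].
have QI : (forall x y y', Q (x, y) -> Q (x, y') -> y = y') /\
          (forall x x' y, Q (x, y) -> Q (x', y) -> x = x').
  split=> [x y y'|x x' y] h h'; have [n [hn hn']] := chain2 _ _ h h';
  have [_ [P1 P2 _]] := PP n; [exact: P1 hn hn' | exact: P2 hn hn'].
exists Q; split; last first.
- by move=> n; apply: Dmono (PQ n.+1) _; have [] := PS n.
- exact: PQ 0.
case: QI => Q1 Q2; split=> // t tQ.
(* Being a partial isomorphism has finite character: only a [t] with some projection a simplex
   matters. Simplexes are finite and both projections are injective on [Q], so such a [t] is finite
   and lies within one stage [P n]. *)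
suff main : simplexes X (fst @` t) \/ simplexes Y (snd @` t) ->
    simplexes X (fst @` t) <-> simplexes Y (snd @` t).
  by split=> h; [apply/(main (or_introl h)) | apply/(main (or_intror h))].
have fint : simplexes X (fst @` t) \/ simplexes Y (snd @` t) -> finite_set t.
  case=> /simplex_finite; rewrite (eq_finite_set (B := t)) //;
  apply: inj_card_eq => -[a b] [a' b'] /set_mem/tQ + /set_mem/tQ + /= e;
  rewrite -e => h; first [by move/(Q1 _ _ _ h) -> | by move/(Q2 _ _ _ h) ->].
move=> /fint /chain /(_ tQ) [n tn].
by have [_ [_ _]] := PP n; apply.
Qed.

(** * Going forth, and going back and forth *)

(** Stage [n] serves the vertex numbered [n] by [e]. A number that [e] does not take imposes no
    requirement, so finite and infinite complexes are treated alike. *)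
Lemma forth_step (e : vertex X -> nat) n P : injective e -> extensible X Y ->
  finite_set P -> partial_iso P ->
  exists Q, [/\ finite_set Q, partial_iso Q, P `<=` Q &
    forall x, e x = n -> exists y, Q (x, y)].
Proof.
move=> eI ext finP isoP.
case: (pselect (exists x, e x = n)) => [[x ex]|nx]; last first.
  by exists P; split=> // x ex; case: nx; exists x.
have [y iso] := ext P finP isoP x.
exists (P `|` [set (x, y)]); split=> //.
- by rewrite finite_setU; split=> //; exact: finite_set1.
- by move=> x'; rewrite -ex => /eI ->; exists y; right.
Qed.

Lemma countable_complex_inj (Z : complex) : countable_complex Z ->
  exists e : vertex Z -> nat, injective e.
Proof.
move=> /countable_injP [e eI]; exists e => x y; apply: eI; exact: mem_set.
Qed.

Lemma forth : countable_complex X -> extensible X Y ->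
  exists f : vertex X -> vertex Y, injective f /\
    forall s, simplexes X s <-> simplexes Y (f @` s).
Proof.
move=> /countable_complex_inj [e eI] ext.
pose D n P := forall x, e x = n -> exists y : vertex Y, P (x, y).
have [n P Q PQ DP x /DP [y /PQ]|n P|||Q [isoQ _ DQ]] :=
  @partial_iso_chain D set0.
- by exists y.
- exact: forth_step.
- exact: finite_set0.
- exact: partial_iso0.
have [|f [_ fI fs]] := partial_iso_total isoQ; last by exists f.
by move=> x; exact: DQ.
Qed.

End PartialIso.

Lemma back_and_forth (X Y : complex) (P : set (vertex X * vertex Y)) :
  countable_complex X -> countable_complex Y ->
  extensible X Y -> extensible Y X -> finite_set P -> partial_iso P ->
  exists f : vertex X -> vertex Y,
    isomorphism f /\ forall x y, P (x, y) -> f x = y.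
Proof.
move=> /countable_complex_inj [e eI] /countable_complex_inj [e' e'I].
move=> extXY extYX finP isoP.
pose D n Q := (forall x, e x = n -> exists y, Q (x, y)) /\
              (forall y, e' y = n -> exists x, Q (x, y)).
have [n P1 P2 P12 [D1 D2]|n P1 fin1 iso1|//|//|Q [isoQ PQ DQ]] :=
  @partial_iso_chain X Y D P.
- by split=> [x /D1 [y /P12]|y /D2 [x /P12]] h; [exists y | exists x].
- have [P2 [fin2 iso2 P12 D2]] := forth_step n eI extXY fin1 iso1.
  (* The back step is a forth step on the converse graph, with [X] and [Y] exchanged. *)
  have [P3 [fin3 iso3 P23 D3]] := forth_step n e'I extYX
    (finite_converse fin2) (partial_iso_converse iso2).
  have P13 : P2 `<=` converse P3 by move=> [x y] P2xy; exact: (P23 (y, x)).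
  exists (converse P3); split.
  + exact: finite_converse.
  + exact: partial_iso_converse.
  + exact: subset_trans P13.
  + by split=> [x /D2 [y /P13]|y /D3 [x]] h; [exists y | exists x].
have [x|y|f [fiso fQ]] := partial_iso_isomorphism isoQ.
- by have [h _] := DQ (e x); exact: h.
- by have [_ h] := DQ (e' y); exact: h.
exists f; split=> // x y /PQ; case: isoQ => Q1 _ _; exact: Q1.
Qed.

(** * Extensibility of ample complexes *)

Lemma ample_extensible (X Y : complex) : infinitely_ample Y -> extensible X Y.
Proof.
move=> [_ amp] P finP isoP x.
case: (pselect (exists y, P (x, y))) => [[y Pxy]|nx].
  by exists y; apply: partial_iso_sub isoP => p [] // ->.
have [P1 P2 P3] := isoP.
(* [A] is the link of [x] within the domain of [P], carried to [Y] by [P]. Using subgraphs [t] of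
   [P] describes a simplex and its image at once. *)
pose A := [set s | exists t, [/\ t `<=` P, t !=set0, s = snd @` t &
                     simplexes X (fst @` t `|` [set x])]].
have [|y [nUy linkA]] := amp (snd @` P) (finite_image _ finP) A.
  split=> [s [t [tP [p tp] -> Xt]]|s s' [t [tP _ -> Xt]] s't [z s'z]].
    split; last exact: image_subset.
    apply/P3 => //; apply: simplex_sub Xt _ _; first by move=> ? ?; left.
    by exists p.1, p.
  (* The face [s'] is witnessed by the part of the subgraph [t] that projects into it. *)
  exists (t `&` snd @^-1` s'); split.
  - by move=> p [/tP].
  - by have [p tp pz] := s't z s'z; exists p; split=> //=; rewrite pz.
  - apply/seteqP; split=> [w s'w|_ [p [_ ?] <-] //].
    by have [p tp pw] := s't w s'w; exists p => //; split=> //=; rewrite pw.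
  - apply: simplex_sub Xt _ _; last by exists x; right.
    by move=> w [[p [tp _] <-]|->]; [left; exists p | right].
have nPy x' : ~ P (x', y) by move=> h; apply: nUy; exists (x', y).
have nPx y' : ~ P (x, y') by move=> h; apply: nx; exists y'.
exists y; split.
- move=> a b b' [h|[-> ->]] [h'|[]] //; first exact: P1 h h'.
  + by move=> ea; move: h; rewrite ea => /nPx.
  + by move: h' => /nPx.
- move=> a a' b [h|[-> ->]] [h'|[]] //; first exact: P2 h h'.
  + by move=> _ eb; move: h; rewrite eb => /nPy.
  + by move: h' => /nPy.
move=> t tP; case: (pselect (t (x, y))) => [txy|ntxy]; last first.
  by apply: P3 => p tp; have [//|pE] := tP p tp; case: ntxy; rewrite -pE.
(* Once [(x, y)] is split off, the rest [u] lies in [P]. If [u] is empty, both projections of [t]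
   are single vertexes; otherwise each projection is a simplex exactly when that of [u] lies in the
   link of the new vertex, and [linkA] compares the two links. *)
pose u := t `&` P.
have tE : t = u `|` [set (x, y)].
  apply/seteqP; split=> [p tp|p [[]//|->//]].
  by have [Pp|->] := tP p tp; [left | right].
rewrite tE !image_setU !image_set1 /=.
case: (pselect (u !=set0)) => [[p up]|/nonemptyPn ->]; last first.
  by rewrite !image_set0 !set0U; split=> _; exact: simplex_vertex.
have uP : u `<=` P by move=> q [].
have uU : snd @` u `<=` snd @` P by exact: image_subset.
split=> Hu.
- have : A (snd @` u) by exists u; split=> //; exists p.
  by rewrite -linkA => -[[]].
- have : A (snd @` u).
    have Yu : simplexes Y (snd @` u).
      by apply: simplex_sub Hu _ _ => [? ?|]; [left | exists p.2, p].
    by rewrite -linkA; split; split=> // /uU.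
  (* Membership in [A] only yields some subgraph [v] with the same second projection as [u];
     injectivity of [P] forces [v = u]. *)
  move=> [v [vP _ uv]]; suff -> : v = u by [].
  have inc w w' : w `<=` P -> w' `<=` P -> snd @` w = snd @` w' -> w `<=` w'.
    move=> wP w'P ww' [a b] wab; have : (snd @` w') b.
      by rewrite -ww'; exists (a, b).
    move=> [[a' b'] w'ab' /= bb']; rewrite bb' in w'ab'.
    by rewrite (P2 _ _ _ (wP _ wab) (w'P _ w'ab')).
  by apply/seteqP; split; apply: inc.
Qed.

(** * Extensibility from universality and homogeneity *)

Lemma induced_partial_iso (X Y : complex) (U : set (vertex X))
    (W : set (vertex Y)) (P : set (vertex X * vertex Y)) : partial_iso P ->
  partial_iso ([set p | P (val p.1, val p.2)] :
    set (vertex (induced U) * vertex (induced W))).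
Proof.
move=> [P1 P2 P3]; split=> /=.
- by move=> x y y' h /(P1 _ _ _ h) /val_inj.
- by move=> x x' y h /(P2 _ _ _ h) /val_inj.
move=> t tP; rewrite /induced_simplexes /= !image_comp.
have := P3 ((fun p => (val p.1, val p.2)) @` t); rewrite !image_comp /=.
move=> [|h1 h2]; first by move=> _ [p tp <-]; exact: tP.
split=> -[h _]; split.
- exact: h1.
- by move=> _ [p _ <-]; exact: set_valP.
- exact: h2.
- by move=> _ [p _ <-]; exact: set_valP.
Qed.

(** Homogeneity speaks of maps between induced complexes. Taking [U] and [W] to be the projections
    of [P] makes the graph total in both directions, hence an isomorphism to which homogeneity
    applies. *)
Lemma homogeneous_partial_iso (X : complex) (P : set (vertex X * vertex X)) :
  homogeneous X -> finite_set P -> partial_iso P ->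
  exists F : vertex X -> vertex X,
    isomorphism F /\ forall x y, P (x, y) -> F x = y.
Proof.
move=> hom finP isoP; pose U := fst @` P; pose W := snd @` P.
have [||f [fiso fP]] := partial_iso_isomorphism (induced_partial_iso U W isoP).
- move=> x; have [[a b] Pab /= ax] := set_valP x.
  have Wb : b \in W by apply: mem_set; exists (a, b).
  by exists (SigSub Wb); rewrite /= -ax.
- move=> y; have [[a b] Pab /= yb] := set_valP y.
  have Ua : a \in U by apply: mem_set; exists (a, b).
  by exists (SigSub Ua); rewrite /= -yb.
have [F [Fiso FE]] := hom U W (finite_image _ finP) (finite_image _ finP) f fiso.
exists F; split=> // x y Pxy.
have Ux : x \in U by apply: mem_set; exists (x, y).
rewrite (FE (SigSub Ux)); case: isoP => P1 _ _.
exact: P1 (fP (SigSub Ux)) Pxy.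
Qed.

Lemma universal_embedding (X Y : complex) : universal Y -> countable_complex X ->
  exists g : vertex X -> vertex Y, injective g /\
    forall s, simplexes X s <-> simplexes Y (g @` s).
Proof.
move=> univ /univ [U [f [/bij_inj fI fs]]]; exists (fun x => val (f x)).
split=> [x x' /val_inj /fI //|s]; rewrite fs /= image_comp.
split=> [[]//|h]; split=> //; move=> _ [x _ <-]; exact: set_valP.
Qed.

Lemma universal_homogeneous_extensible (X Y : complex) : countable_complex X ->
  universal Y -> homogeneous Y -> extensible X Y.
Proof.
move=> cX univ hom P finP [P1 P2 P3] x.
have [g [gI gs]] := universal_embedding univ cX.
(* [G] is [P] composed with the inverse of [g], a finite partial isomorphism from [Y] to itself. An
   automorphism [F] of [Y] extending it makes [F \o g] agree with [P]. *)
pose G := (fun p => (g p.1, p.2)) @` P.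
have isoG : partial_iso G.
  split.
  - by move=> _ y y' [[a b] Pab [<- <-]] [[a' b'] Pab' [/gI aa' <-]];
      apply: P1 Pab _; rewrite -aa'.
  - by move=> a1 a2 _ [[a b] Pab [<- <-]] [[a' b'] Pab' [<- bb']];
      congr g; apply: P2 Pab _; rewrite -bb'.
  - move=> t tG; pose u := P `&` [set p | t (g p.1, p.2)].
    have tE : t = (fun p => (g p.1, p.2)) @` u.
      apply/seteqP; split=> [p tp|_ [p [_ tp] <-] //].
      by have [q Pq qp] := tG p tp; exists q => //; split=> //=; rewrite qp.
    rewrite tE !image_comp -[X in simplexes Y X <-> _](image_comp fst g) -gs.
    by apply: P3 => p [].
have [F [[/bij_inj FI Fs] FG]] :=
  homogeneous_partial_iso hom (finite_image _ finP) isoG.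
(* The embedding [F \o g] is defined on all of [X], so its value at [x] extends [P]: the enlarged
   graph is a restriction of the graph of [F \o g]. *)
exists (F (g x)).
apply: (@partial_iso_sub _ _ _ [set p | p.2 = (F \o g) p.1]).
  move=> [a b] [Pab|[-> ->]] //=.
  by apply/esym/FG; exists (a, b).
apply: graph_partial_iso; first exact: inj_comp.
by move=> s; rewrite gs Fs image_comp.
Qed.

(** * Universality and homogeneity from extensibility *)

Lemma extensible_universal (X : complex) :
  (forall Y, countable_complex Y -> extensible Y X) -> universal X.
Proof.
move=> ext Y cY; have [f [fI fs]] := forth cY (ext Y cY).
exists (range f).
have fr y : f y \in range f by apply: mem_set; exists y.
exists (fun y => SigSub (fr y)); split.
  have /choice [g gP] (z : range f) : exists y, f y = val z.
    by have [y _ <-] := set_valP z; exists y.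
  exists g => [y|z]; first by apply: fI; rewrite gP.
  by apply: val_inj; rewrite /= gP.
move=> s; rewrite fs /= /induced_simplexes /= image_comp.
by split=> [h|[]//]; split=> // _ [y _ <-]; exists y.
Qed.

(** Reading the graph of [f] in the ambient vertex type makes it a possible start for the
    back-and-forth construction. Simplexes of an induced complex are tested through [val], and
    containment in [U] or [W] is then automatic. *)
Lemma isomorphism_partial_iso (X : complex) (U W : set (vertex X))
    (f : vertex (induced U) -> vertex (induced W)) : isomorphism f ->
  partial_iso (range (fun u : U => (val u, val (f u)))).
Proof.
move=> [/bij_inj fI fs]; split.
- by move=> _ _ _ [u _ [<- <-]] [u' _ [/val_inj -> <-]].
- by move=> _ _ _ [u _ [<- <-]] [u' _ [<- /val_inj/fI ->]].
move=> t tf; pose s := [set u : U | t (val u, val (f u))].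
have -> : t = (fun u : U => (val u, val (f u))) @` s.
  apply/seteqP; split=> [p tp|_ [u su <-] //].
  by have [u _ up] := tf p tp; exists u => //; rewrite /s /= up.
have := fs s; rewrite /= /induced_simplexes /= !image_comp => -[h1 h2].
split=> h.
- by have [|] := h1; first by split=> // _ [u _ <-]; exact: set_valP.
- by have [|] := h2; first by split=> // _ [u _ <-]; exact: set_valP.
Qed.

Lemma extensible_homogeneous (X : complex) :
  countable_complex X -> extensible X X -> homogeneous X.
Proof.
move=> cX ext U W finU _ f fiso.
have isoP := isomorphism_partial_iso fiso.
have finP : finite_set (range (fun u : U => (val u, val (f u)))).
  (* [finU] concerns a set of ambient vertexes; the injection [val] transfers finiteness to the type
     of its elements, over which the graph is indexed. *)
  apply: finite_image; have : finite_set (range (val : U -> vertex X)).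
    by apply: sub_finite_set finU => _ [u _ <-]; exact: set_valP.
  rewrite (eq_finite_set (B := [set: U])) //.
  by apply: inj_card_eq => ? ? _ _ /val_inj.
have [F [Fiso FE]] := back_and_forth cX cX ext ext finP isoP.
by exists F; split=> // u; apply: FE; exists u.
Qed.

Theorem theorem9p3 (R : complex) (hR : rado_complex R) :
  universal R /\
  homogeneous R /\
  (forall X : complex, countable_complex X -> universal X -> homogeneous X ->
     isomorphic X R).
Proof.
have [cR ampR] := hR; split; first last; first split.
- by apply: extensible_homogeneous => //; exact: ample_extensible.
- move=> X cX univX homX.
  (* Ampleness of [R] gives the forth steps, universality and homogeneity of [X] the back steps; the
     construction starts from the empty graph. *)
  have [f [fiso _]] := back_and_forth cX cR (ample_extensible ampR)
    (universal_homogeneous_extensible cR univX homX) (finite_set0 _)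
    (partial_iso0 X R).
  by exists f.
- by apply: extensible_universal => Y _; exact: ample_extensible.
Qed.
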